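(* Let $R$ be a maximal non valuative domain, and let $R'$ be the integral closure of $R$ in $\mathrm{qf}(R)$. Then $R'$ is a Prüfer domain. Moreover, if $R'$ is local, then $R'$ is a valuation domain.
   Context: All rings are commutative with identity and are integral domains; $\mathrm{qf}(R)$ denotes the quotient field of $R$. A local ring is a ring with a unique maximal ideal (not necessarily Noetherian). An overring of $R$ is a subring of $\mathrm{qf}(R)$ containing $R$. An integral domain $R$ is a valuative domain if for each nonzero $x\in \mathrm{qf}(R)$, at least one of the extensions $R\subseteq R[x]$ and $R\subseteq R[x^{-1}]$ has no ring strictly between its two ends (equality of the two ends is allowed). An integral domain $R$ is a maximal non valuative domain if $R$ is not a valuative domain but every overring of $R$ properly containing $R$ is a valuative domain. *)

(* Defs.v *)
From HB Require Import structures.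
From mathcomp Require Import all_boot all_order all_algebra.
From mathcomp Require Import boolp classical_sets.

Set Implicit Arguments.
Unset Strict Implicit.
Unset Printing Implicit Defensive.

Import GRing.Theory.
Local Open Scope classical_set_scope.
Local Open Scope ring_scope.

(* An integral domain [R : idomainType] is identified with its image in
   [{fraction R}], so that [R], its overrings and its integral closure are all
   subrings of one field.  The definitions of this section are meant for a
   subset [T] of a field [K] that is a subring of [K]. *)
Section SubringsOfAField.
Variable K : fieldType.
Implicit Types (T A B S I J M : set K) (x y z : K).

Definition subring S : Prop := GRing.subring_closed (mem S).

Definition quotient_field T : set K :=
  [set z | exists a b, [/\ T a, T b, b != 0 & z = a / b]].

(* This is the ring T[x]. *)
Definition adjoin T x : set K :=
  [set y | exists2 p : {poly K}, (forall i, T p`_i) & y = p.[x]].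

Definition no_ring_strictly_between A B : Prop :=
  forall S, subring S -> A `<=` S -> S `<=` B -> S = A \/ S = B.

Definition valuative_domain T : Prop :=
  forall x, quotient_field T x -> x != 0 ->
    no_ring_strictly_between T (adjoin T x)
    \/ no_ring_strictly_between T (adjoin T x^-1).

Definition overring T S : Prop :=
  [/\ subring S, T `<=` S & S `<=` quotient_field T].

Definition maximal_non_valuative_domain T : Prop :=
  ~ valuative_domain T
  /\ (forall S, overring T S -> T `<` S -> valuative_domain S).

Definition valuation_domain T : Prop :=
  forall x, quotient_field T x -> x != 0 -> T x \/ T x^-1.

Definition submodule T J : Prop :=
  [/\ J `<=` quotient_field T, J 0,
      forall x y, J x -> J y -> J (x + y)
    & forall a x, T a -> J x -> J (a * x)].

Definition ideal T I : Prop := submodule T I /\ I `<=` T.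

Definition maximal_ideal T M : Prop :=
  [/\ ideal T M, M <> T &
      forall J, ideal T J -> M `<=` J -> J = M \/ J = T].

Definition local_ring T : Prop := exists! M, maximal_ideal T M.

Definition fractional_ideal T J : Prop :=
  submodule T J
  /\ (exists d, [/\ T d, d != 0 & forall x, J x -> T (d * x)]).

Definition ideal_mul I J : set K :=
  [set z | exists n (a b : 'I_n -> K),
     [/\ forall i, I (a i), forall i, J (b i) & z = \sum_(i < n) a i * b i]].

Definition invertible_ideal T I : Prop :=
  exists2 J, fractional_ideal T J & ideal_mul I J = T.

Definition ideal_span T n (g : 'I_n -> K) : set K :=
  [set z | exists2 c : 'I_n -> K,
     forall i, T (c i) & z = \sum_(i < n) c i * g i].

Definition finitely_generated T I : Prop :=
  exists n (g : 'I_n -> K), I = ideal_span T g.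

Definition prufer_domain T : Prop :=
  forall I, ideal T I -> finitely_generated T I -> I <> [set 0] ->
    invertible_ideal T I.

End SubringsOfAField.

Definition image_in_fractions (R : idomainType) : set {fraction R} :=
  range (@FracField.tofrac R).

Definition integral_closure (R : idomainType) : set {fraction R} :=
  [set z | integralOver (@FracField.tofrac R) z].

Arguments image_in_fractions R : clear implicits.
Arguments integral_closure R : clear implicits.

Lemma subring_image_in_fractions (R : idomainType) :
  subring (image_in_fractions R).
Proof.
split=> [|x y|x y]; rewrite ?inE.
- by exists 1; rewrite ?tofrac1.
- by move=> [a _ <-] [b _ <-]; exists (a - b); rewrite ?tofracB.
- by move=> [a _ <-] [b _ <-]; exists (a * b); rewrite ?tofracM.
Qed.

Lemma subring_integral_closure (R : idomainType) :
  subring (integral_closure R).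
Proof.
split; first by apply/mem_set; exact: integral1.
- move=> x y /set_mem xI /set_mem yI; apply/mem_set; exact: integral_sub xI yI.
- move=> x y /set_mem xI /set_mem yI; apply/mem_set; exact: integral_mul xI yI.
Qed.

Lemma quotient_field_image_in_fractions (R : idomainType) :
  quotient_field (image_in_fractions R) = setT.
Proof.
apply/seteqP; split=> // z _; elim/quotW: z => x.
exists (FracField.tofrac (val x).1), (FracField.tofrac (val x).2).
have x0 : FracField.tofrac (val x).2 != 0 by rewrite tofrac_eq0 denom_ratioP.
split; [by exists (val x).1 | by exists (val x).2 | exact: x0 |].
apply: (mulIf x0); rewrite mulfVK //.
move: x0 => _; unlock FracField.tofrac.
rewrite -[LHS]FracField.pi_mul; apply/eqmodP.
rewrite /= FracField.equivfE /FracField.mulf !numden_Ratio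
  ?mulr1 ?mul1r ?oner_eq0 ?denom_ratioP //; last by rewrite mulrC.
Qed.

(* Main.v *)
Require Import Defs.
From mathcomp Require Import all_boot all_order all_algebra.
From mathcomp Require Import boolp classical_sets ring.

Import GRing.Theory.
Local Open Scope classical_set_scope.
Local Open Scope ring_scope.

(** Let [T] be the integral closure and let [x] be such that [(1, x)] is not an
    invertible [T]-module.  The coefficients of every polynomial over [T]
    vanishing at [x] lie in the trace ideal [I] of [(1, x)], a proper ideal, so
    [T[x]] maps onto [(T/I)[X]] and monic nonconstant polynomials in [x] are
    nonunits of [R[x]].  Four pairwise comaximal nonunits [a, b, c, d] make
    [R[x]] non valuative, as witnessed by [ab/(cd)]; but [R[x]] properly
    contains [R], which is a contradiction.  Hence all the modules [(1, x)] are
    invertible, [T] is Prüfer, and in the local case [T] is a valuation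
    domain. *)

(** * Subrings of a field and simple ring extensions *)

Section Subrings.
Variables (K : fieldType) (T : set K).
Hypothesis subringT : subring T.

Lemma subring1 : T 1.
Proof. by case: subringT => /set_mem. Qed.

Lemma subringB x y : T x -> T y -> T (x - y).
Proof.
by case: subringT => _ TB _ Tx Ty; apply/set_mem/TB; apply/mem_set.
Qed.

Lemma subringM x y : T x -> T y -> T (x * y).
Proof.
by case: subringT => _ _ TM Tx Ty; apply/set_mem/TM; apply/mem_set.
Qed.

Lemma subring0 : T 0.
Proof. by rewrite -(subrr 1); apply: subringB subring1 subring1. Qed.

Lemma subringN x : T x -> T (- x).
Proof. by rewrite -sub0r; apply: subringB subring0. Qed.

Lemma subringD x y : T x -> T y -> T (x + y).
Proof. by move=> Tx Ty; rewrite -[y]opprK; apply/subringB/subringN. Qed.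

Lemma subringX x n : T x -> T (x ^+ n).
Proof.
move=> Tx; elim: n => [|n IHn]; first by rewrite expr0; exact: subring1.
by rewrite exprS; apply: subringM.
Qed.

Lemma subring_sum (I : Type) (r : seq I) (P : pred I) (F : I -> K) :
  (forall i, P i -> T (F i)) -> T (\sum_(i <- r | P i) F i).
Proof. by move=> TF; apply: big_ind; [exact: subring0 | exact: subringD |]. Qed.

Lemma subring_polyC c : T c -> forall i, T (c%:P)`_i.
Proof. by move=> Tc i; rewrite coefC; case: eqP => // _; exact: subring0. Qed.

Lemma subring_polyX i : T ('X : {poly K})`_i.
Proof.
by rewrite coefX; case: eqP => _; [exact: subring1 | exact: subring0].
Qed.

Lemma subring_polyB (p q : {poly K}) :
  (forall i, T p`_i) -> (forall i, T q`_i) -> forall i, T (p - q)`_i.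
Proof. by move=> Tp Tq i; rewrite coefB; apply: subringB. Qed.

Lemma subring_polyD (p q : {poly K}) :
  (forall i, T p`_i) -> (forall i, T q`_i) -> forall i, T (p + q)`_i.
Proof. by move=> Tp Tq i; rewrite coefD; apply: subringD. Qed.

Lemma subring_polyM (p q : {poly K}) :
  (forall i, T p`_i) -> (forall i, T q`_i) -> forall i, T (p * q)`_i.
Proof.
by move=> Tp Tq i; rewrite coefM; apply: subring_sum => j _; apply: subringM.
Qed.

Lemma sub_adjoin x : T `<=` adjoin T x.
Proof.
by move=> c Tc; exists c%:P; [exact: subring_polyC | rewrite hornerC].
Qed.

Lemma mem_adjoin x : adjoin T x x.
Proof. by exists 'X; [exact: subring_polyX | rewrite hornerX]. Qed.

Lemma subring_adjoin x : subring (adjoin T x).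
Proof.
split=> [|_ _ /set_mem[p Tp ->] /set_mem[q Tq ->]|
          _ _ /set_mem[p Tp ->] /set_mem[q Tq ->]]; apply/mem_set.
- exact/sub_adjoin/subring1.
- by exists (p - q); [exact: subring_polyB | rewrite hornerD hornerN].
- by exists (p * q); [exact: subring_polyM | rewrite hornerM].
Qed.

End Subrings.

Lemma adjoin_sub (K : fieldType) (T A : set K) x :
  subring A -> T `<=` A -> A x -> adjoin T x `<=` A.
Proof.
move=> subA TA Ax _ [p Tp ->]; rewrite horner_coef.
apply: subring_sum => // i _; apply: subringM => //; first exact: TA.
exact: subringX.
Qed.

Lemma adjoin_inv_denominator (K : fieldType) (T : set K) a y :
  subring T -> T a -> a != 0 -> adjoin T a^-1 y -> exists n, T (a ^+ n * y).
Proof.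
(* [size p] exceeds every exponent of [a^-1] that occurs in [p.[a^-1]]. *)
move=> subT Ta a0 [p Tp ->]; exists (size p).
rewrite horner_coef mulr_sumr; apply: subring_sum => // i _.
rewrite mulrCA; apply: subringM => //.
have -> : a ^+ size p = a ^+ (size p - i) * a ^+ i.
  by rewrite -exprD subnK // ltnW.
by rewrite exprVn mulfK ?expf_neq0 //; exact: subringX.
Qed.

(** * Comaximal nonunits and intermediate rings *)

Section ComaximalNonunits.
Variables (K : fieldType) (S : set K).
Hypothesis subringS : subring S.

(* [S[1/a]] lies strictly between [S] and [S[1/(ab)]], as [b] is not a unit of
   the former.  Since [0^-1 = 0], the hypothesis [~ S a^-1] implies [a != 0]. *)
Lemma intermediate_ring a b u w z :
  S a -> S b -> S u -> S w -> u * a + w * b = 1 ->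
  ~ S a^-1 -> ~ S b^-1 -> adjoin S z (a * b)^-1 ->
  ~ no_ring_strictly_between S (adjoin S z).
Proof.
move=> Sa Sb Su Sw uawb Sa1 Sb1 zab noS.
have neq0 c : ~ S c^-1 -> c != 0.
  by move=> Sc; apply/eqP => c0; apply: Sc; rewrite c0 invr0; exact: subring0.
have [a0 b0] := (neq0 a Sa1, neq0 b Sb1).
have subz := subring_adjoin _ _ subringS z.
have inz c d : S d -> c * d = a * b -> adjoin S z c^-1.
  move=> Sd cd; have -> : c^-1 = d * (a * b)^-1.
    rewrite -cd; have := mulf_neq0 a0 b0; rewrite -cd mulf_eq0 negb_or.
    by case/andP=> c0 d0; field; apply/andP.
  by apply: subringM => //; apply: sub_adjoin.
have [E|E] := noS _ (subring_adjoin _ _ subringS a^-1)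
  (sub_adjoin _ _ subringS a^-1)
  (adjoin_sub _ _ _ _ subz (sub_adjoin _ _ subringS z) (inz a b Sb erefl)).
  by apply: Sa1; rewrite -E; exact: mem_adjoin.
have: adjoin S z b^-1 by apply: inz Sa _; rewrite mulrC.
rewrite -E => /(adjoin_inv_denominator _ _ _ _ subringS Sa a0)[n].
(* Comaximality lowers the power of [a] one at a time, until [b^-1] itself lies in [S]. *)
elim: n => [|n IHn]; first by rewrite expr0 mul1r.
move=> San; apply: IHn.
have -> : a ^+ n * b^-1 = u * (a ^+ n.+1 * b^-1) + w * a ^+ n.
  by rewrite -[LHS]mul1r -uawb exprS; field.
by apply: subringD => //; apply: subringM => //; exact: subringX.
Qed.

(** Take [z = ab/(cd)]. Dividing the third relation by [cd] puts [1/(cd)] in [S[z]], and dividing it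
    by [ab] puts [1/(ab)] in [S[1/z]], so [intermediate_ring] refutes both alternatives for [z]. *)
Lemma nonunits_not_valuative a b c d u1 w1 u2 w2 u3 w3 :
  S a -> S b -> S c -> S d ->
  S u1 -> S w1 -> S u2 -> S w2 -> S u3 -> S w3 ->
  u1 * a + w1 * b = 1 -> u2 * c + w2 * d = 1 ->
  u3 * (a * b) + w3 * (c * d) = 1 ->
  ~ S a^-1 -> ~ S b^-1 -> ~ S c^-1 -> ~ S d^-1 -> ~ valuative_domain S.
Proof.
move=> Sa Sb Sc Sd Su1 Sw1 Su2 Sw2 Su3 Sw3 ab cd abcd Sa1 Sb1 Sc1 Sd1 valS.
have neq0 y : ~ S y^-1 -> y != 0.
  by move=> Sy; apply/eqP => y0; apply: Sy; rewrite y0 invr0; exact: subring0.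
have [a0 b0] := (neq0 a Sa1, neq0 b Sb1).
have [c0 d0] := (neq0 c Sc1, neq0 d Sd1).
pose z := (a * b) / (c * d).
have z0 : z != 0 by rewrite mulf_neq0 ?invr_eq0 ?mulf_neq0.
have qz : quotient_field S z.
  exists (a * b), (c * d).
  by split=> //; [exact: subringM | exact: subringM | exact: mulf_neq0].
have adjI y s t : S s -> S t -> adjoin S y (s * y + t).
  move=> Ss St; have subSy := subring_adjoin _ _ subringS y.
  apply: subringD => //; last exact: sub_adjoin.
  by apply: subringM => //; [exact: sub_adjoin | exact: mem_adjoin].
case: (valS z qz z0).
- apply: (intermediate_ring c d u2 w2) => //.
  have -> : (c * d)^-1 = u3 * z + w3.
    by rewrite -[LHS]mul1r -abcd /z; field; apply/andP.
  exact: adjI.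
- apply: (intermediate_ring a b u1 w1) => //.
  have -> : (a * b)^-1 = w3 * z^-1 + u3.
    by rewrite -[LHS]mul1r -abcd /z; field; rewrite a0 b0 c0 d0.
  exact: adjI.
Qed.

End ComaximalNonunits.

(** * Trace ideals over an integrally closed ring *)

Section IntegrallyClosed.
Variables (K : fieldType) (T : set K).
Hypothesis subringT : subring T.
Hypothesis closedT : forall (p : {poly K}) y,
  p \is monic -> (forall i, T p`_i) -> root p y -> T y.

(** The colon ideal of [x] in [T], which is also the inverse of the module [(1, x)]. *)
Definition denominators (x : K) : set K := [set b | T b /\ T (b * x)].

(* The trace ideal of the fractional ideal [(1, x)]; it is [T] exactly when
   [(1, x)] is invertible. *)
Definition trace (x : K) : set K :=
  [set z | exists b c, [/\ denominators x b, denominators x c & z = b + c * x]].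

Lemma denominatorsB x b c :
  denominators x b -> denominators x c -> denominators x (b - c).
Proof.
by case=> Tb Tbx [Tc Tcx]; split; rewrite ?mulrBl; exact: subringB.
Qed.

Lemma denominatorsM x a b :
  T a -> denominators x b -> denominators x (a * b).
Proof. by move=> Ta [Tb Tbx]; split; rewrite -?mulrA; exact: subringM. Qed.

Lemma denominators0 x : denominators x 0.
Proof. by split; rewrite ?mul0r; exact: subring0. Qed.

Lemma traceB x y z : trace x y -> trace x z -> trace x (y - z).
Proof.
move=> [b [c [Db Dc ->]]] [b' [c' [Db' Dc' ->]]].
exists (b - b'), (c - c'); split; [exact: denominatorsB..|by ring].
Qed.

Lemma traceM x a y : T a -> trace x y -> trace x (a * y).
Proof.
move=> Ta [b [c [Db Dc ->]]]; exists (a * b), (a * c).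
by split; [exact: denominatorsM.. | rewrite mulrDr mulrA].
Qed.

Lemma trace0 x : trace x 0.
Proof.
by exists 0, 0; rewrite mul0r addr0; split=> //; exact: denominators0.
Qed.

Lemma traceD x y z : trace x y -> trace x z -> trace x (y + z).
Proof.
move=> Iy Iz; rewrite -[z]opprK; apply: traceB => //.
by rewrite -sub0r; apply: traceB => //; exact: trace0.
Qed.

Lemma trace_sum x (I : Type) (r : seq I) (P : pred I) (F : I -> K) :
  (forall i, P i -> trace x (F i)) -> trace x (\sum_(i <- r | P i) F i).
Proof. by move=> IF; apply: big_ind; [exact: trace0 | exact: traceD |]. Qed.

(** For [k > 0], multiplying the relation by [y^(k-1)] turns it into a monic equation over [T] for
    [y * x]; for [k = 0] it says [y = 0]. *)
Lemma integral_lead_coef (c : {poly K}) x y k :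
  T y -> (forall i, T c`_i) -> (size c <= k)%N ->
  c.[x] + y * x ^+ k = 0 -> T (y * x).
Proof.
move=> Ty Tc; case: k => [|k] szc.
  rewrite (_ : c = 0) ?horner0 ?add0r ?expr0 ?mulr1.
    by move=> ->; rewrite mul0r; exact: subring0.
  by apply/eqP; rewrite -size_poly_eq0 -leqn0.
move=> cy0.
pose r := \poly_(i < k.+1) (c`_i * y ^+ (k - i)).
have szr : (size r < size ('X^(k.+1) : {poly K}))%N.
  by rewrite size_polyXn ltnS size_poly.
apply: (closedT ('X^(k.+1) + r)).
- by rewrite monicE lead_coefDl // lead_coefXn.
- apply: (subring_polyD _ _ subringT) => i.
    by rewrite coefXn; case: eqP => _; [exact: subring1 | exact: subring0].
  rewrite coef_poly; case: ifP => _; last exact: subring0.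
  by apply: subringM => //; exact: subringX.
- apply/rootP; rewrite hornerD hornerXn horner_poly.
  have -> :
      \sum_(i < k.+1) c`_i * y ^+ (k - i) * (y * x) ^+ i = y ^+ k * c.[x].
    rewrite (horner_coef_wide _ szc) mulr_sumr; apply: eq_bigr => i _.
    have -> : y ^+ k = y ^+ (k - i) * y ^+ i by rewrite -exprD subnK // -ltnS.
    by rewrite exprMn; ring.
  rewrite exprMn [y ^+ k.+1]exprS.
  rewrite (_ : _ + _ = y ^+ k * (c.[x] + y * x ^+ k.+1)).
    by rewrite cy0 mulr0.
  by ring.
Qed.

(* Truncating Horner's scheme: with [b_k] the value at [x] of [drop_poly k p],
   each [b_k] is a denominator of [x] and [p`_k = b_k - b_(k+1) x]. *)
Lemma trace_coef (p : {poly K}) x i :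
  (forall i, T p`_i) -> root p x -> trace x p`_i.
Proof.
move=> Tp /rootP px0.
have dropE k : (drop_poly k p).[x] = p`_k + (drop_poly k.+1 p).[x] * x.
  rewrite -(hornerC p`_k x) -hornerMX -hornerD; congr horner.
  apply/polyP=> -[|j]; rewrite coefD coefC coefMX !coef_drop_poly /=.
    by rewrite add0n addr0.
  by rewrite add0r addnS addSn.
have Db k : denominators x (drop_poly k p).[x].
  have [/drop_poly_eq0 ->|/ltnW kp] := leqP (size p) k.
    by rewrite horner0; exact: denominators0.
  (* Downward induction on the index, from [size p], where [drop_poly] gives 0. *)
  rewrite -(subKn kp); elim: (size p - k)%N => {k kp} [|n IHn].
    by rewrite subn0 drop_poly_eq0 // horner0; exact: denominators0.
  have [pn|np] := leqP (size p) n.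
    have /eqP -> : (size p - n.+1 == 0)%N by rewrite subn_eq0 leqW.
    by move: IHn; have /eqP -> : (size p - n == 0)%N by [].
  set k := (size p - n.+1)%N.
  have Ek : k.+1 = (size p - n)%N by rewrite /k -subSn.
  rewrite -Ek in IHn; case: IHn => _ Tkx.
  (* First [b_k = p_k + b_(k+1) x] lies in [T]; then [b_k] is the leading coefficient in [p.[x] = 0]
     regrouped as a part of degree below [k] plus [b_k x^k], so [b_k x] lies in [T]. *)
  have Tk : T (drop_poly k p).[x] by rewrite dropE; exact: subringD.
  split=> //; apply: (integral_lead_coef (take_poly k p) x _ k Tk).
  - by move=> j; rewrite coef_take_poly; case: ifP => // _; exact: subring0.
  - exact: size_take_poly.
  - by rewrite -[RHS]px0 -[p in RHS](poly_take_drop k) hornerD hornerM hornerXn.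
exists (drop_poly i p).[x], (- (drop_poly i.+1 p).[x]); split=> //.
  by rewrite -sub0r; apply: denominatorsB => //; exact: denominators0.
by rewrite dropE; ring.
Qed.

(* By [trace_coef], [T[x]] maps onto the polynomial ring over [T / trace x],
   where a monic polynomial of positive degree is not a unit. *)
Lemma monic_nonunit (q : {poly K}) x :
  ~ trace x 1 -> q \is monic -> (forall i, T q`_i) -> (1 < size q)%N ->
  ~ adjoin T x q.[x]^-1.
Proof.
move=> I1 mon_q Tq szq [g Tg gE].
have qx0 : q.[x] != 0.
  apply/eqP => /rootP /(trace_coef _ _ (size q).-1 Tq).
  by rewrite -lead_coefE (monicP mon_q).
set d := (size q).-1.
have d_gt0 : (0 < d)%N by rewrite /d; case: (size q) szq => [|[]].
have szqE : size q = d.+1 by rewrite /d prednK // ltnW.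
(* [g.[x]] is the supposed inverse, so [h] vanishes at [x] and its coefficients lie in the trace
   ideal. *)
pose h := g * q - 1.
have Ih i : trace x h`_i.
  apply: trace_coef.
    apply: subring_polyB => //; first exact: subring_polyM.
    by move=> j; rewrite -polyC1; apply: subring_polyC => //; exact: subring1.
  by apply/rootP; rewrite /h hornerD hornerN hornerM hornerC -gE mulVf ?subrr.
pose r := q - 'X^d.
have r0 k : (d <= k)%N -> r`_k = 0.
  rewrite leq_eqVlt coefB coefXn => /orP[/eqP <-|dk].
    by rewrite eqxx -lead_coefE (monicP mon_q) subrr.
  by rewrite nth_default ?szqE // gtn_eqF // subr0.
have Tr k : T r`_k.
  apply: subring_polyB => // i; rewrite coefXn.
  by case: eqP => _; [exact: subring1 | exact: subring0].
(* Descending induction on [i]. In degree [i + d > 0] the constant 1 is invisible, and [r] has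
   degree below [d], so the coefficient of [g * q] is [g_i] plus terms in [g_j] with [j > i]. *)
have Ig n i : (size g <= i + n)%N -> trace x g`_i.
  elim: n i => [|n IHn] i.
    by rewrite addn0 => /(nth_default 0) ->; exact: trace0.
  move=> gin.
  have -> : g`_i = h`_(i + d) - (g * r)`_(i + d).
    rewrite /h coefB coef1 addn_eq0 (gtn_eqF d_gt0) andbF subr0.
    rewrite -coefB -mulrBr /r opprB addrC subrK.
    by rewrite coefMXn ltnNge leq_addl /= addnK.
  apply: traceB => //; rewrite coefM; apply: trace_sum => j _.
  have [ji|ij] := leqP j i.
    rewrite r0 ?mulr0; first exact: trace0.
    by rewrite -addnBAC // leq_addl.
  rewrite mulrC; apply: traceM => //; apply: IHn; apply: leq_trans gin _.
  by rewrite addnS -addSn leq_add2r.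
apply: I1; have -> : 1 = (g * q)`_0 - h`_0.
  by rewrite /h coefB coef1 /=; ring.
apply: traceB => //; rewrite coefM; apply: trace_sum => j _.
by rewrite mulrC; apply: traceM => //; apply: (Ig (size g)); exact: leq_addl.
Qed.

(* [X], [X + 1], [e + 1] and [e * (e + 1) + 1] with [e = X * (X + 1)] are
   pairwise comaximal over any ring, as in Euclid's proof that there are
   infinitely many primes. *)
Lemma adjoin_not_valuative (A : set K) x :
  subring A -> A `<=` T -> ~ trace x 1 -> ~ valuative_domain (adjoin A x).
Proof.
move=> subA AT I1.
pose S := adjoin A x; pose e := x * (x + 1).
have subS : subring S by exact: subring_adjoin.
have nonunit (q : {poly K}) : q \is monic -> (forall i, A q`_i) ->
    (1 < size q)%N -> S q.[x] /\ ~ S q.[x]^-1.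
  move=> mon_q Aq szq; split; first by exists q.
  move=> Sq1; apply: (monic_nonunit q x I1 mon_q _ szq) => [i|].
    exact/AT.
  by case: Sq1 => p Ap ->; exists p => // i; apply: AT.
have A1 : forall i, A (1 : {poly K})`_i.
  by move=> i; rewrite -polyC1; apply: subring_polyC => //; exact: subring1.
have AX : forall i, A ('X : {poly K})`_i by apply: subring_polyX.
pose E : {poly K} := 'X * ('X + 1).
have monX1 : 'X + 1 \is @monic K by rewrite -polyC1 monicXaddC.
have szX1 : size ('X + 1 : {poly K}) = 2 by rewrite -polyC1 size_XaddC.
have monE : E \is monic by rewrite monicMl ?monicX.
have szE : size E = 3.
  by rewrite size_monicM ?monicX ?monic_neq0 ?szX1 ?size_polyX.
have AX1 : forall i, A ('X + 1 : {poly K})`_i by apply: subring_polyD.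
have AE : forall i, A E`_i by apply: subring_polyM.
have addr1 (q : {poly K}) : q \is monic -> (1 < size q)%N ->
    q + 1 \is monic /\ size (q + 1) = size q.
  move=> mon_q szq; rewrite monicE lead_coefDl ?size_poly1 //.
  by rewrite -monicE size_polyDl ?size_poly1.
have [monE1 szE1] := addr1 E monE (ltac:(by rewrite szE)).
have szEE1 : size (E * (E + 1)) = 5.
  by rewrite size_monicM ?monic_neq0 // szE1 szE.
have monEE1 : E * (E + 1) \is monic by rewrite monicMl.
have [monE2 szE2] := addr1 _ monEE1 (ltac:(by rewrite szEE1)).
have AE1 : forall i, A (E + 1)`_i by apply: subring_polyD.
have AE2 : forall i, A (E * (E + 1) + 1)`_i.
  by apply: subring_polyD => //; apply: subring_polyM.
have := nonunit 'X (monicX _) AX (ltac:(by rewrite size_polyX)).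
have := nonunit _ monX1 AX1 (ltac:(by rewrite szX1)).
have := nonunit _ monE1 AE1 (ltac:(by rewrite szE1 szE)).
have := nonunit _ monE2 AE2 (ltac:(by rewrite szE2 szEE1)).
rewrite !(hornerD, hornerM, hornerX) -!polyC1 !hornerC -/e.
move=> [Sd Sd1] [Sc Sc1] [Sb Sb1] [Sa Sa1].
have S1 : S 1 by exact: subring1.
have SN1 : S (- 1) by exact: subringN.
have Se : S e by apply: subringM.
(* The last cofactors come from [ab = e] and [cd = (e + 1)(e^2 + e + 1) = e (e^2 + 2e + 2) + 1]. *)
apply: (nonunits_not_valuative _ S subS x (x + 1) (e + 1) (e * (e + 1) + 1)
  (- 1) 1 (- e) 1 (- (e ^+ 2 + e + e + 1 + 1)) 1) => //.
- exact: subringN.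
- by apply: subringN => //; do 4! [apply: subringD => //]; apply: subringX.
- by rewrite /e; ring.
- by ring.
- by rewrite -/e; ring.
Qed.

End IntegrallyClosed.
Arguments trace {K} T x.

(** * From invertible pairs to invertible ideals *)

Section TraceOne.
Variables (K : fieldType) (T : set K).
Hypothesis subringT : subring T.
Hypothesis quotientT : quotient_field T = setT.
Hypothesis trace1 : forall x, trace T x 1.

(** For [h != 0], write [1 = b + c x] with [x = g / h] and take [u = b], [v = b x], [w = c]. Where
    [u] is invertible [h] divides [g], and where [1 - u] is invertible [g] divides [h]. *)
Lemma pair_comaximal (g h : K) : exists u v w,
  [/\ T u, T v, T w, u * g = v * h & (1 - u) * h = w * g].
Proof.
have [->|h0] := eqVneq h 0.
  by exists 0, 0, 0; rewrite !mul0r !mulr0; split=> //; exact: subring0.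
have [b [c [[Tb Tbx] [Tc Tcx] bc]]] := trace1 (g / h).
exists b, (b * (g / h)), c; split=> //; first by field.
by rewrite bc; field.
Qed.

(** A partition of unity: wherever [s i] is invertible, [g i] alone generates the module spanned by
    [g]. *)
Lemma comaximal_cover n (g : 'I_n.+1 -> K) : exists s : 'I_n.+1 -> K,
  [/\ forall i, T (s i), \sum_i s i = 1
    & forall i j, exists2 t, T t & s i * g j = t * g i].
Proof.
elim: n g => [|n IHn] g.
  exists (fun=> 1); split=> [_||i j]; [exact: subring1 | by rewrite big_ord1 |].
  by exists 1; [exact: subring1 | rewrite !ord1].
have [s [Ts s1 sg]] := IHn (fun i => g (lift ord0 i)).
have [u Pu] := choice (fun i => pair_comaximal (g ord0) (g (lift ord0 i))).
have Tu i : T (u i) by have [v [w []]] := Pu i.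
(* Each old weight [s k] is split by comparing its generator with [g ord0]: the share [u k] stays,
   and the share [1 - u k] goes to [g ord0]. *)
pose s' i := if unlift ord0 i is Some k then s k * u k
             else \sum_k s k * (1 - u k).
have T1 := subring1 _ _ subringT.
exists s'; split.
- move=> i; rewrite /s'; case: unliftP => [k _|_]; first exact: subringM.
  by apply: subring_sum => // k _; apply: subringM => //; exact: subringB.
- rewrite big_ord_recl /s' unlift_none.
  under [X in _ + X]eq_bigr do rewrite liftK.
  by rewrite -big_split /= -[RHS]s1; apply: eq_bigr => k _; ring.
- move=> i j; rewrite /s'; case: (unliftP ord0 i) => [k ->|->].
    case: (unliftP ord0 j) => [l ->|->].
      have [t Tt E] := sg k l.
      by exists (t * u k); [exact: subringM | rewrite mulrAC E; ring].
    have [v [w [_ Tv _ E _]]] := Pu k.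
    by exists (s k * v); [exact: subringM | rewrite -mulrA E mulrA].
  case: (unliftP ord0 j) => [l ->|->].
    have H k : exists t, T t /\ s k * (1 - u k) * g (lift ord0 l) = t * g ord0.
      have [v [w [_ _ Tw _ E]]] := Pu k; have [t Tt E'] := sg k l.
      exists (t * w); split; first exact: subringM.
      by rewrite mulrAC E' -[RHS]mulrA -E /=; ring.
    have [t Pt] := choice H.
    exists (\sum_k t k); first by apply: subring_sum => // k _; case: (Pt k).
    by rewrite !mulr_suml; apply: eq_bigr => k _; case: (Pt k).
  exists (\sum_k s k * (1 - u k)) => //; apply: subring_sum => // k _.
  by apply: subringM => //; exact: subringB.
Qed.

Lemma submodule_span n (g : 'I_n -> K) : submodule T (ideal_span T g).
Proof.
split.
- by rewrite quotientT.
- exists (fun=> 0) => [_|]; first exact: subring0.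
  by rewrite big1 // => i _; rewrite mul0r.
- move=> _ _ [c Tc ->] [d Td ->]; exists (fun i => c i + d i).
    by move=> i; exact: subringD.
  by rewrite -big_split; apply: eq_bigr => i _; rewrite mulrDl.
- move=> a _ Ta [c Tc ->]; exists (fun i => a * c i).
    by move=> i; exact: subringM.
  by rewrite mulr_sumr; apply: eq_bigr => i _; rewrite mulrA.
Qed.

Lemma mem_span n (g : 'I_n -> K) i : ideal_span T g (g i).
Proof.
exists (fun j => (j == i)%:R).
  by move=> j; case: eqP => _; [exact: subring1 | exact: subring0].
rewrite (bigD1 i) //= eqxx mul1r big1 ?addr0 // => j /negPf ->.
by rewrite mul0r.
Qed.

(** The inverse is spanned by the [s i / g i]: each [(s i / g i) * g j] lies in [T], and the
    diagonal products sum to 1. *)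
Lemma prufer_of_trace1 : prufer_domain T.
Proof.
move=> I [subI IT] [n [g Ig]] I0; subst I.
have gT i : T (g i) by exact/IT/mem_span.
have [i0 gi0] : exists i, g i != 0.
  apply: contrapT => g0; apply: I0; apply/seteqP; split=> [_ [c _ ->]|_ ->] /=.
    apply: big1 => i _; have [->|gi] := eqVneq (g i) 0; first by rewrite mulr0.
    by case: g0; exists i.
  by case: subI.
case: n => [|n] in g subI IT I0 gT i0 gi0 *; first by case: i0 gi0.
have [s [Ts s1 sg]] := comaximal_cover n g.
have sgT i j : T (s i / g i * g j).
  have [t Tt E] := sg i j; rewrite mulrAC E.
  have [->|gi] := eqVneq (g i) 0; first by rewrite mulr0 mul0r; exact: subring0.
  by rewrite mulfK.
exists (ideal_span T (fun i => s i / g i)).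
  split; first exact: submodule_span.
  exists (g i0); split=> // _ [c Tc ->]; rewrite mulr_sumr.
  apply: subring_sum => // i _; rewrite mulrCA; apply: subringM => //.
  by rewrite mulrC.
apply/seteqP; split=> [_ [m [a [b [Ia Jb ->]]]]|t Tt].
  apply: subring_sum => // k _; have [c Tc ->] := Ia k; have [d Td ->] := Jb k.
  rewrite mulr_suml; apply: subring_sum => // i _.
  rewrite mulr_sumr; apply: subring_sum => // j _.
  rewrite (_ : _ * _ = c i * d j * (s j / g j * g i)); last by ring.
  by apply: subringM => //; apply: subringM.
exists n.+1, g, (fun i => t * (s i / g i)); split.
- by move=> i; exact: mem_span.
- move=> i; have [_ _ _ JM] := submodule_span _ (fun i => s i / g i).
  by apply: JM => //; exact: mem_span.
rewrite -[t in LHS]mulr1 -s1 mulr_sumr; apply: eq_bigr => i _.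
(* When [g i = 0] the quotient [s i / g i] is 0 by convention, so [s i] must vanish too:
   [s i * g i0] is a multiple of [g i], and [g i0 != 0]. *)
have [gi|gi] := eqVneq (g i) 0; last by field.
have [t' _] := sg i i0; rewrite gi mulr0 => /eqP.
by rewrite mulf_eq0 (negPf gi0) orbF => /eqP ->; rewrite mul0r !mulr0.
Qed.

(** * Maximal ideals and the local case *)

Lemma ideal_with1 (I : set K) : ideal T I -> I 1 -> I = T.
Proof.
move=> [[_ _ _ IM] IT] I1; apply/seteqP; split=> // t Tt.
by rewrite -[t]mulr1; exact: IM.
Qed.

Lemma nonunit_in_maximal_ideal y :
  T y -> ~ T y^-1 -> exists2 M, maximal_ideal T M & M y.
Proof.
move=> Ty Ty1.
pose P I := I = set0 \/ [/\ ideal T I, I y & ~ I 1].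
have y0 : y != 0.
  by apply/eqP => y0; apply: Ty1; rewrite y0 invr0; exact: subring0.
have Py : P (ideal_span T (fun _ : 'I_1 => y)).
  right; split; last 2 first.
  - exact: (mem_span _ _ ord0).
  - move=> [c Tc]; rewrite big_ord1 => E; apply: Ty1.
    by rewrite -[y^-1]mul1r E mulfK.
  split; first exact: submodule_span.
  by move=> _ [c Tc ->]; rewrite big_ord1; exact: subringM.
have [F FP totF|M [PM maxM]] := @Zorn_bigcup _ P.
  have [[I0 [FI0 I0n0]]|F0] := pselect (exists I, F I /\ I !=set0); last first.
    left; apply/seteqP; split=> // z [I FI Iz].
    by case: F0; exists I; split=> //; exists z.
  have nz I z : F I -> I z -> [/\ ideal T I, I y & ~ I 1].
    by move=> FI Iz; case: (FP I FI) => // I_0; rewrite I_0 in Iz.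
  have [z0 I0z0] := I0n0.
  have [[[_ I00 _ _] _] I0y _] := nz _ _ FI0 I0z0.
  right; split; [split; [split|]| |].
  - by rewrite quotientT.
  - by exists I0.
  - move=> u v [I FI Iu] [J FJ Jv].
    have [[[_ _ ID _] _] _ _] := nz _ _ FI Iu.
    have [[[_ _ JD _] _] _ _] := nz _ _ FJ Jv.
    have [IJ|JI] := totF _ _ FI FJ.
      by exists J => //; apply: JD => //; exact: IJ.
    by exists I => //; apply: ID => //; exact: JI.
  - move=> a u Ta [I FI Iu]; have [[[_ _ _ IM] _] _ _] := nz _ _ FI Iu.
    by exists I => //; exact: IM.
  - by move=> u [I FI Iu]; have [[_ IT] _ _] := nz _ _ FI Iu; exact: IT.
  - by exists I0.
  - by move=> [I FI I1]; have [_ _] := nz _ _ FI I1.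
have [M0|[idM My M1]] := PM.
  exfalso; apply: (maxM _ _ Py); rewrite M0; split=> // sub0.
  by case: (sub0 y); exact: (mem_span _ _ ord0).
exists M => //; split=> //.
  by move=> MT; apply: M1; rewrite MT; exact: subring1.
move=> J idJ MJ; have [J1|J1] := pselect (J 1).
  by right; exact: ideal_with1.
left; apply: contrapT => JM; apply: (maxM J).
  by split=> // JsubM; apply: JM; apply/seteqP.
by right; split=> //; exact: MJ.
Qed.

(** In [1 = b + c x] one of [b] and [c x] lies outside the maximal ideal, hence is a unit. Then
    [x = b^-1 (b x)] or [x^-1 = c (c x)^-1] lies in [T]. *)
Lemma local_valuation : local_ring T -> valuation_domain T.
Proof.
move=> [M [[idM MT _] uniqM]] x _ x0.
have [[_ _ MD _] _] := idM.
have M1 : ~ M 1 by move=> M1; apply: MT; exact: ideal_with1.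
have [b [c [[Tb Tbx] [Tc Tcx] bc]]] := trace1 x.
have unitVM y : T y -> T y^-1 /\ y != 0 \/ M y.
  move=> Ty; have [Ty1|Ty1] := pselect (T y^-1); last first.
    have [M' maxM' M'y] := nonunit_in_maximal_ideal y Ty Ty1.
    by right; rewrite (uniqM M' maxM').
  have [->|] := eqVneq y 0; last by left.
  by right; case: idM => [[]].
have [[Tb1 b0]|Mb] := unitVM b Tb.
  by left; rewrite -(mulKf b0 x); exact: subringM.
have [[Tcx1 cx0]|Mcx] := unitVM (c * x) Tcx; last first.
  by case: M1; rewrite bc; exact: MD.
right; have -> : x^-1 = c * (c * x)^-1.
  by move: cx0; rewrite mulf_eq0 negb_or => /andP[c0 _]; field; apply/andP.
exact: subringM.
Qed.

End TraceOne.

(** * Application to the integral closure *)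

Theorem corollary2p3 (R : idomainType)
    (hR : maximal_non_valuative_domain (image_in_fractions R)) :
  prufer_domain (integral_closure R)
  /\ (local_ring (integral_closure R) -> valuation_domain (integral_closure R)).
Proof.
set T := integral_closure R; set A := image_in_fractions R.
have subT : subring T by exact: subring_integral_closure.
have subA : subring A by exact: subring_image_in_fractions.
have AT : A `<=` T by move=> _ [a _ <-]; exact: integral_id.
have qT : quotient_field T = setT.
  apply/seteqP; split=> // z _.
  have : quotient_field A z by rewrite quotient_field_image_in_fractions.
  by move=> [a [b [Aa Ab b0 ->]]]; exists a, b; split=> //; exact: AT.
have closedT (p : {poly {fraction R}}) y :
    p \is monic -> (forall i, T p`_i) -> root p y -> T y.
  move=> mon_p Tp py; apply: (integral_root_monic mon_p py).
  by move=> _ /(nthP 0)[i _ <-]; exact: Tp.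
have trace1 x : trace T x 1.
  apply: contrapT => I1.
  have [_ maxA] := hR.
  apply: (adjoin_not_valuative _ T subT closedT A x) => //; apply: maxA.
    split; [exact: subring_adjoin | exact: sub_adjoin |].
    by rewrite quotient_field_image_in_fractions.
  (* The inclusion of [R] in [R[x]] is proper: if [x] were in [R], then 1 would be a denominator of
     [x], and [1 = 1 + 0 x] would lie in the trace ideal. *)
  split; first exact: sub_adjoin.
  move=> /(_ x (mem_adjoin _ _ subA x)) /AT Tx; apply: I1.
  exists 1, 0; rewrite mul0r addr0; split=> //; last exact: denominators0.
  by split; rewrite ?mul1r //; exact: subring1.
split; first exact: prufer_of_trace1.
exact: local_valuation.
Qed.
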